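(* Let $k,n\in\mathbb{N}$ with $3\le k<n$. (i) Suppose that either $k\ge 5$ and $n\ge 20$, or $k=4$ and $n\ge 30$. Let $M$ be any set of fewer than $n$ edges of $K_n^{(k)}$ such that $n$ divides $|E(K_n^{(k)})\setminus M|$. Then $K_n^{(k)}-M$ has a decomposition into Hamilton Berge cycles. (ii) Suppose that $k=3$ and $n\ge 100$. If $\binom{n}{3}$ is not divisible by $n$, let $M$ be any perfect matching in $K_n^{(3)}$; otherwise let $M=\emptyset$. Then $K_n^{(3)}-M$ has a decomposition into Hamilton Berge cycles.
   Context: $K_n^{(k)}$ is the complete $k$-uniform hypergraph on $n$ vertices (all $k$-subsets of an $n$-set are edges). For a set $M$ of edges, $K_n^{(k)}-M$ is the hypergraph on the same vertex set with edge set $E(K_n^{(k)})\setminus M$. A perfect matching is a set of pairwise disjoint edges covering all vertices. A Berge cycle is an alternating sequence $v_1,e_1,v_2,e_2,\dots,v_n,e_n$ of distinct vertices $v_i$ and distinct edges $e_i$ such that each $e_i$ contains $v_i$ and $v_{i+1}$ (with $v_{n+1}=v_1$). It is a Hamilton Berge cycle of a hypergraph $G$ if $\{v_1,\dots,v_n\}$ is the vertex set of $G$ and each $e_i$ is an edge of $G$. A decomposition into Hamilton Berge cycles is a collection of Hamilton Berge cycles whose edge sets partition the edge set of the hypergraph. *)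

(* Defs.v *)
From mathcomp Require Import all_boot.

Set Implicit Arguments.
Unset Strict Implicit.
Unset Printing Implicit Defensive.

(* A hypergraph is given by its edge set G : {set {set V}}; its vertex set is
   the whole finite type V. *)

Section Hypergraphs.
Variable V : finType.
Implicit Types (G M : {set {set V}}) (C : seq (V * {set V})).

Definition complete_hypergraph (k : nat) : {set {set V}} :=
  [set e : {set V} | #|e| == k].

Definition perfect_matching G M : Prop :=
  [/\ M \subset G, trivIset M & cover M = [set: V]].

(* The alternating sequence v_1, e_1, ..., v_m, e_m is encoded as the sequence
   of pairs (v_1, e_1), ..., (v_m, e_m). *)
Definition cycle_vertices C : {set V} := [set v in unzip1 C].
Definition cycle_edges C : {set {set V}} := [set e in unzip2 C].

(* [cycle] also relates the last pair to the first: v_{m+1} = v_1. *)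
Definition Berge_cycle C : Prop :=
  [/\ uniq (unzip1 C), uniq (unzip2 C)
    & cycle (fun p q : V * {set V} => (p.1 \in p.2) && (q.1 \in p.2)) C].

Definition Hamilton_Berge_cycle G C : Prop :=
  [/\ Berge_cycle C, cycle_vertices C = [set: V] & cycle_edges C \subset G].

Definition Hamilton_Berge_decomposition G (Cs : seq (seq (V * {set V}))) : Prop :=
  [/\ forall C, C \in Cs -> Hamilton_Berge_cycle G C,
      pairwise (fun C D => [disjoint cycle_edges C & cycle_edges D]) Cs
    & \bigcup_(C <- Cs) cycle_edges C = G].

Definition has_Hamilton_Berge_decomposition G : Prop :=
  exists Cs, Hamilton_Berge_decomposition G Cs.

End Hypergraphs.

Notation "''K_' n ^( k )" := (complete_hypergraph 'I_n k)
  (at level 8, n at level 2, k at level 99, format "''K_' n ^( k )").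

(* Main.v *)
Require Import Defs.
From mathcomp Require Import all_boot zify.

Set Implicit Arguments.
Unset Strict Implicit.
Unset Printing Implicit Defensive.

(* Fix m Hamilton cycles of the complete graph covering all pairs almost equally
   often, where m n is the number of available k-sets, and use Hall's theorem to
   assign bijectively to each k-set a cycle edge contained in it.

   The cycles are the rotations of a zigzag on Z_(n-1) closed through a point at
   infinity: any n - 1 consecutive rotations cover each pair exactly twice. So
   Hall's condition says, up to a bounded error per pair, that a graph with p
   ordered adjacent pairs has at most p C(n,k) / (n (n - 1)) k-cliques. If p' is
   the number of ordered non-adjacent pairs, counting a clique from each of its
   vertices and comparing C(d, k-1) with d (d - 1) gives the stronger bound
   (p - min(p, p')/6) C(n,k) / (n (n - 1)), and the gain absorbs the errors.
   When 4 k >= 3 n there may be too few k-sets for that, but then every k-set contains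
   at least half of the cycle edges and every pair lies in at least half of the
   k-sets, which yields Hall's condition at once. *)

(** * Hall's theorem and Berge cycles *)

Section Hall.
Variables T U : finType.
Implicit Types (A S : {set T}) (r : T -> U -> bool).

Definition neighbours r S : {set U} := [set b | [exists a in S, r a b]].

Lemma neighboursP r S b :
  reflect (exists2 a, a \in S & r a b) (b \in neighbours r S).
Proof. by rewrite inE; apply: exists_inP. Qed.

(** Induction on [#|A|]. If a proper nonempty [S] is tight, [S] and [A :\: S] are matched
    separately. Otherwise every such [S] has a neighbour to spare, so any single pair [a], [b] can
    be matched and removed. [u0] is only a default value for an empty [A]. *)
Lemma Hall_marriage (u0 : U) r A :
    (forall S, S \subset A -> #|S| <= #|neighbours r S|) ->
  exists2 f : T -> U, {in A &, injective f} & {in A, forall a, r a (f a)}.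
Proof.
have [c] := ubnP #|A|; elim: c => // c IH in r A * => leAc hall.
have [->|[a aA]] := set_0Vmem A; first by exists (fun=> u0) => x; rewrite inE.
have [/existsP[S /and4P[S0 SA SnA tight]]|] :=
  boolP [exists S : {set T}, [&& S != set0, S \subset A, S != A
                               & #|neighbours r S| == #|S|]].
  have ltSA : #|S| < #|A| by rewrite proper_card // properEneq SnA.
  have [f fI fr] : exists2 f : T -> U,
      {in S &, injective f} & {in S, forall a, r a (f a)}.
    apply: IH => [|S' S'S]; first by lia.
    exact/hall/(subset_trans S'S).
  (* Outside [S] the neighbours of [S] are forbidden. Hall's condition survives: apply it to
     [S :|: S'] and subtract the tight equality for [S]. *)
  pose r' a b := r a b && (b \notin neighbours r S).
  have [f' f'I f'r] : exists2 f : T -> U,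
      {in A :\: S &, injective f} & {in A :\: S, forall a, r' a (f a)}.
    apply: IH => [|S' S'A].
      have := cardsID S A; rewrite (setIidPr SA).
      by have := card_gt0 S; rewrite S0; lia.
    have S'S0 : [disjoint S & S'].
      rewrite disjoint_sym; apply/pred0P => x /=; apply/andP => -[xS' xS].
      by have /setDP[_ /negP] := subsetP S'A x xS'.
    have := hall (S :|: S'); rewrite subUset SA (subset_trans S'A (subsetDl _ _)).
    move=> /(_ isT); rewrite cardsU (disjoint_setI0 S'S0) cards0 subn0.
    have : neighbours r (S :|: S') \subset neighbours r S :|: neighbours r' S'.
      apply/subsetP => b /neighboursP[x /setUP[xS|xS'] rxb]; rewrite in_setU.
        by apply/orP; left; apply/neighboursP; exists x.
      have [//|nb] := boolP (b \in neighbours r S).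
      by apply/neighboursP; exists x => //; rewrite /r' rxb.
    move=> /subset_leq_card; rewrite cardsU; have := eqP tight; lia.
  exists (fun x => if x \in S then f x else f' x).
    move=> x y xA yA /=.
    have key z t : z \in S -> t \in A -> t \notin S -> f z != f' t.
      move=> zS tA tS; have /andP[_] : r' t (f' t) by apply: f'r; rewrite inE tS.
      by apply: contraNneq => <-; apply/neighboursP; exists z; rewrite ?fr.
    case: ifP => xS; case: ifP => yS; first exact: fI.
    - by move=> /eqP; rewrite (negPf (key _ _ _ _ _)) ?yS.
    - by move/esym/eqP; rewrite (negPf (key _ _ _ _ _)) ?xS.
    - by apply: f'I; rewrite inE ?xS ?yS.
  move=> x xA /=; case: ifP => xS; first exact: fr.
  by have /andP[] : r' x (f' x) by apply: f'r; rewrite inE xS.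
move=> /existsPn strict.
have [b rab] : exists b, r a b.
  have : 0 < #|neighbours r [set a]| by rewrite (leq_trans _ (hall _ _)) ?cards1 ?sub1set.
  by rewrite card_gt0 => /set0Pn[b /neighboursP[x /set1P-> ?]]; exists b.
pose r' x y := r x y && (y != b).
have [f fI fr] : exists2 f : T -> U,
    {in A :\ a &, injective f} & {in A :\ a, forall x, r' x (f x)}.
  apply: IH => [|S SA]; first by have := cardsD1 a A; rewrite aA; lia.
  have [->|S0] := eqVneq S set0; first by rewrite cards0.
  have := strict S; rewrite S0 (subset_trans SA (subD1set _ _)) /=.
  have -> /= : S != A.
    by apply: contraTneq aA => <-; apply: contraTN SA => aS;
       apply/subsetPn; exists a; rewrite ?inE ?eqxx.
  have /hall : S \subset A by rewrite (subset_trans SA (subD1set _ _)).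
  have : neighbours r S \subset b |: neighbours r' S.
    apply/subsetP => y /neighboursP[x xS rxy]; rewrite !inE.
    have [//|yb] := eqVneq y b; apply/exists_inP; exists x => //.
    by rewrite /r' rxy.
  move=> /subset_leq_card; rewrite cardsU1; case: (_ \notin _) => /=; lia.
exists (fun x => if x == a then b else f x).
  move=> x y xA yA /=.
  have key z : z \in A -> z != a -> f z != b.
    by move=> zA za; have /andP[] : r' z (f z) by apply: fr; rewrite !inE za.
  have [->|xa] := eqVneq x a; have [->|ya] := eqVneq y a => //.
  - by move=> /esym/eqP; rewrite (negPf (key _ _ _)).
  - by move=> /eqP; rewrite (negPf (key _ _ _)).
  - by apply: fI; rewrite !inE ?xa ?ya.
move=> x xA /=; have [->//|xa] := eqVneq x a.
by have /andP[] : r' x (f x) by apply: fr; rewrite !inE xa.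
Qed.

End Hall.

Lemma cycle_mkseq (T : Type) (e : rel T) (F : nat -> T) n :
  (forall i, i < n -> e (F i) (F (i.+1 %% n))) -> cycle e (mkseq F n).
Proof.
case: n => // n eF.
have -> : mkseq F n.+1 = F 0 :: map F (iota 1 n) by [].
rewrite /cycle; apply/(pathP (F 0)) => i; rewrite size_rcons size_map size_iota => lti.
rewrite nth_rcons size_map size_iota -/(mkseq F n.+1).
have -> : nth (F 0) (F 0 :: rcons (map F (iota 1 n)) (F 0)) i = F i.
  case: i lti => [|i] lti //; rewrite /= nth_rcons size_map size_iota.
  have lt_in : i < n by rewrite -ltnS.
  by rewrite lt_in (nth_map 0) ?size_iota // nth_iota.
have := eF i lti; case: (ltnP i n) => [ltin|].
  by rewrite (nth_map 0) ?size_iota // nth_iota // modn_small.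
move=> leni; have -> : i = n by apply/eqP; rewrite eqn_leq leni -ltnS lti.
by rewrite eqxx modnn.
Qed.

Section DecompositionFromHall.
Variables (n m : nat) (w : nat -> nat -> 'I_n) (A : {set {set 'I_n}}).
Hypothesis w_inj : forall i, {in gtn n &, injective (w i)}.

(** A pair [b = (i, j)] is a slot: the [j]-th edge of the [i]-th cycle, to be replaced by a
    hyperedge containing it. *)
Definition cycle_edge_in (e : {set 'I_n}) (b : 'I_m * 'I_n) :=
  (w b.1 b.2 \in e) && (w b.1 (b.2.+1 %% n) \in e).

(** There are as many slots as hyperedges, so the matching is a bijection. Its inverse [h] fills
    every slot, which turns each cycle [w i] into a Berge cycle and uses each hyperedge once. *)
Lemma Hamilton_Berge_decomposition_of_Hall :
    0 < n -> #|A| = m * n ->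
    (forall S : {set {set 'I_n}}, S \subset A ->
      #|S| <= #|neighbours cycle_edge_in S|) ->
  has_Hamilton_Berge_decomposition A.
Proof.
move=> n0 cardA hall.
have [m0|m_gt0] := posnP m.
  exists [::]; split=> //; apply/esym/eqP.
  by rewrite big_nil -cards_eq0 cardA m0.
have [f fI fr] := Hall_marriage (Ordinal m_gt0, Ordinal n0) hall.
have fA : f @: A = [set: 'I_m * 'I_n].
  by apply/eqP; rewrite eqEcard subsetT cardsT card_prod !card_ord card_in_imset //= cardA.
have hP b : exists e, (e \in A) && (f e == b).
  have : b \in f @: A by rewrite fA in_setT.
  by case/imsetP=> e eA ->; exists e; rewrite eA eqxx.
pose h b := xchoose (hP b).
have hA b : h b \in A by case/andP: (xchooseP (hP b)).
have fh b : f (h b) = b by case/andP: (xchooseP (hP b)) => _ /eqP.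
have hf e : e \in A -> h (f e) = e by move=> eA; apply: fI; rewrite ?fh.
have hI : injective h by apply: can_inj fh.
(* The defaults of [insubd] never matter: [ij] is only used for [i < m] and [j < n]. *)
pose ij i j : 'I_m * 'I_n := (insubd (Ordinal m_gt0) i, insubd (Ordinal n0) j).
have ij1 i j : i < m -> (ij i j).1 = i :> nat by move=> lti; rewrite val_insubd lti.
have ij2 i j : j < n -> (ij i j).2 = j :> nat by move=> lti; rewrite val_insubd lti.
have ijK (b : 'I_m * 'I_n) : ij b.1 b.2 = b by case: b => i j; rewrite /ij /= !valKd.
have ijI i j i' j' : i < m -> i' < m -> j < n -> j' < n ->
    ij i j = ij i' j' -> i = i' /\ j = j'.
  move=> im im' jn jn' E.
  by have := (ij1 i j im, ij2 i j jn); rewrite E ij1 ?ij2 // => -[-> ->].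
pose C i := mkseq (fun j => (w i j, h (ij i j))) n.
have CE i e : reflect (exists2 j, j < n & e = h (ij i j)) (e \in cycle_edges (C i)).
  rewrite inE /C /mkseq /unzip2 -map_comp.
  apply: (iffP mapP) => -[j]; rewrite ?mem_iota => jn ->; exists j => //.
  by rewrite mem_iota.
exists (mkseq C m); split.
- move=> c /mapP[i]; rewrite mem_iota add0n => /= im ->.
  split; first split.
  + rewrite /C /mkseq /unzip1 -map_comp map_inj_in_uniq ?iota_uniq //.
    by move=> x y; rewrite !mem_iota; apply: w_inj.
  + rewrite /C /mkseq /unzip2 -map_comp map_inj_in_uniq ?iota_uniq //.
    by move=> x y; rewrite !mem_iota /= => xn yn /hI /ijI[].
  + apply: cycle_mkseq => j jn /=.
    by have := fr _ (hA (ij i j)); rewrite fh /cycle_edge_in ij1 ?ij2.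
  + apply/eqP; rewrite eqEcard subsetT cardsT card_ord /= cardsE.
    rewrite /C /mkseq /unzip1 -map_comp (card_uniqP _) ?size_map ?size_iota //.
    rewrite map_inj_in_uniq ?iota_uniq //.
    by move=> x y; rewrite !mem_iota; apply: w_inj.
  + by apply/subsetP => e /CE[j _ ->].
- rewrite /mkseq pairwise_map; apply/(pairwiseP 0) => i i'.
  rewrite !inE !size_iota => im im' ltii' /=; rewrite !nth_iota // !add0n.
  apply/pred0P => e /=; apply/andP => -[/CE[j jn ->] /CE[j' jn' /hI /ijI[]//]].
  by move=> E; rewrite E ltnn in ltii'.
- apply/setP => e; rewrite big_map -{1}(subn0 m) -/(index_iota 0 m) big_mkord.
  apply/bigcupP/idP => [[i _ /CE[j _ ->]] // | eA].
  exists (f e).1 => //; apply/CE; exists (f e).2 => //.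
  by rewrite ijK hf.
Qed.

End DecompositionFromHall.

(** * Cliques and degrees *)

Section Graphs.
Variable V : finType.
Implicit Types (g : rel V) (e : {set V}).

Definition nbr g (v : V) : {set V} := [set u | (u != v) && g v u].
Definition arcs g : {set V * V} := [set p | (p.1 != p.2) && g p.1 p.2].
Definition cliques g k : {set {set V}} :=
  [set e : {set V} | (#|e| == k) && [forall u in e, forall v in e, (u != v) ==> g u v]].

Lemma cliqueP g k e :
  reflect (#|e| = k /\ {in e &, forall u v, u != v -> g u v}) (e \in cliques g k).
Proof.
rewrite inE; apply: (iffP andP) => -[/eqP ek H]; split=> //.
  by move=> u v ue ve; move/forall_inP/(_ u ue)/forall_inP/(_ v ve)/implyP: H.
apply/forall_inP => u ue; apply/forall_inP => v ve; apply/implyP; exact: H.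
Qed.

Lemma card_arcs g : #|arcs g| = \sum_v #|nbr g v|.
Proof.
rewrite -sum1dep_card -(pair_big_dep xpredT (fun u v => (u != v) && g u v)
  (fun _ _ => 1)) /=.
by apply: eq_bigr => v _; rewrite -sum1dep_card; apply: eq_bigl => u; rewrite eq_sym.
Qed.

(** Loops are harmless here, since [nbr], [arcs] and [cliques] all ignore the diagonal. *)
Definition co g : rel V := fun u v => ~~ g u v.

Lemma card_nbr_co g v : #|nbr g v| + #|nbr (co g) v| = #|V|.-1.
Proof.
rewrite -cardsUI.
have -> : nbr g v :&: nbr (co g) v = set0.
  by apply/setP => u; rewrite !inE /co; case: (u != v); case: (g v u).
have -> : nbr g v :|: nbr (co g) v = ~: [set v].
  by apply/setP => u; rewrite !inE /co; case: (u != v); case: (g v u).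
by rewrite cards0 addn0 cardsC1.
Qed.

Lemma card_arcs_co g : #|arcs g| + #|arcs (co g)| = #|V| * #|V|.-1.
Proof.
rewrite !card_arcs -big_split /= (eq_bigr (fun=> #|V|.-1)) ?sum_nat_const //.
by move=> v _; rewrite card_nbr_co.
Qed.

(** Double counting of pairs (clique, vertex in it): removing [v] from a clique leaves a [k]-subset
    of the neighbourhood of [v]. *)
Lemma cliques_nbr_bound g k :
  k.+1 * #|cliques g k.+1| <= \sum_v 'C(#|nbr g v|, k).
Proof.
have -> : k.+1 * #|cliques g k.+1| = \sum_(e in cliques g k.+1) \sum_(v in e) 1.
  rewrite mulnC -sum_nat_const; apply: eq_bigr => e /cliqueP[ek _].
  by rewrite sum1_card.
rewrite (exchange_big_dep xpredT) //=; apply: leq_sum => v _.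
rewrite sum1dep_card -cards_draws.
have -> : #|[set e in cliques g k.+1 | v \in e]|
  = #|[set e :\ v | e in [set e in cliques g k.+1 | v \in e]]|.
  rewrite card_in_imset // => e e'; rewrite !inE => /andP[_ ve] /andP[_ ve'] E.
  by rewrite -(setD1K ve) -(setD1K ve') E.
apply/subset_leq_card/subsetP => _ /imsetP[e /setIdP[/cliqueP[ek gU] ve] ->].
rewrite inE; apply/andP; split; last by have := cardsD1 v e; rewrite ve ek; lia.
apply/subsetP => u; rewrite !inE => /andP[uv ue]; rewrite uv gU //.
by rewrite eq_sym.
Qed.

Lemma mul_bin_diag2 m k :
  k.+2 * (k.+1 * 'C(m, k.+2)) = m * (m.-1 * 'C(m.-2, k)).
Proof. by rewrite mulnCA -(mul_bin_diag m) mulnCA -(mul_bin_diag m.-1). Qed.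

(** Up to the factor k (k - 1), C(d, k) equals d (d - 1) C(d - 2, k - 2), whose last factor grows
    with d. *)
Lemma bin_quadratic_bound N d k : 2 <= k -> d <= N ->
  N * N.-1 * 'C(d, k) <= 'C(N, k) * (d * d.-1).
Proof.
case: k => [|[|k]] // _ le_dN.
rewrite -(leq_pmul2l (ltn0Sn k.+1)) -(leq_pmul2l (ltn0Sn k)).
have -> : k.+1 * (k.+2 * (N * N.-1 * 'C(d, k.+2)))
   = N * N.-1 * (k.+2 * (k.+1 * 'C(d, k.+2))) by lia.
have -> : k.+1 * (k.+2 * ('C(N, k.+2) * (d * d.-1)))
   = d * d.-1 * (k.+2 * (k.+1 * 'C(N, k.+2))) by lia.
have : 'C(d.-2, k) <= 'C(N.-2, k) by apply: leq_bin2l; lia.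
rewrite !mul_bin_diag2 => H.
have -> : N * N.-1 * (d * (d.-1 * 'C(d.-2, k))) = N * N.-1 * (d * d.-1) * 'C(d.-2, k) by lia.
have -> : d * d.-1 * (N * (N.-1 * 'C(N.-2, k))) = N * N.-1 * (d * d.-1) * 'C(N.-2, k) by lia.
by rewrite leq_mul2l H orbT.
Qed.

Lemma cliques_degree_bound g k : 3 <= k ->
  #|V| * (#|V|.-1 * #|V|.-2) * #|cliques g k|
    <= 'C(#|V|, k) * \sum_v #|nbr g v| * #|nbr g v|.-1.
Proof.
case: k => // k lek; set n := #|V|.
have H : n.-1 * n.-2 * (k.+1 * #|cliques g k.+1|)
    <= 'C(n.-1, k) * \sum_v #|nbr g v| * #|nbr g v|.-1.
  rewrite (leq_trans (leq_mul (leqnn _) (cliques_nbr_bound g k))) //.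
  rewrite !big_distrr /=; apply: leq_sum => v _.
  by apply: bin_quadratic_bound; rewrite // /n -(card_nbr_co g v) leq_addr.
rewrite -(leq_pmul2l (ltn0Sn k)) [X in _ <= X]mulnA -mul_bin_diag.
have := leq_mul (leqnn n) H; nia.
Qed.

(* With d(v), d'(v) the degrees of v in the graph and in its complement, and A
   the set of vertices with d' <= d: each pair in A x ~A is counted by one of
   d(v), v \notin A, or d'(u), u \in A, so that
   #|A| * #|~A| <= \sum min(d, d'); while d d' >= (n - 1)/2 * min(d, d'). *)
Lemma sum_degree_products g : symmetric g ->
  #|V|.-1 * minn #|arcs g| #|arcs (co g)|
    <= 6 * \sum_v #|nbr g v| * #|nbr (co g) v|.
Proof.
move=> gS; set N := #|V|.-1.
pose d v := #|nbr g v|; pose d' v := #|nbr (co g) v|.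
have dd v : d v + d' v = N by apply: card_nbr_co.
pose mu := \sum_v minn (d v) (d' v).
have mu_le : N * mu <= 2 * \sum_v d v * d' v.
  rewrite !big_distrr /=; apply: leq_sum => v _; have := dd v.
  by rewrite /minn; case: ltnP; nia.
pose A := [set v | d' v <= d v].
have Emu : mu = \sum_(v in A) d' v + \sum_(v in ~: A) d v.
  rewrite /mu (bigID (fun v => v \in A)) /=; congr (_ + _).
    by apply: eq_bigr => v; rewrite inE => /minn_idPr.
  by apply: eq_big => [v|v]; rewrite ?in_setC // inE -ltnNge => /ltnW/minn_idPl.
have cross : #|A| * #|~: A| <= mu.
  have -> : #|A| * #|~: A| = \sum_(u in A) \sum_(v in ~: A) (~~ g u v : nat)
       + \sum_(v in ~: A) \sum_(u in A) (g v u : nat).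
    rewrite [X in _ = _ + X]exchange_big /= -big_split /=.
    rewrite -sum_nat_const; apply: eq_bigr => u _.
    rewrite -big_split /= -sum1_card; apply: eq_bigr => v _.
    by rewrite (gS v u); case: (g u v).
  have nbr_sum (h : rel V) u (B : {set V}) : u \notin B ->
      \sum_(v in B) (h u v : nat) <= #|nbr h u|.
    move=> uB; rewrite -big_mkcondr /= sum1dep_card; apply/subset_leq_card/subsetP => v.
    by rewrite !inE => /andP[vB ->]; rewrite (contraTneq _ vB) // => ->.
  rewrite Emu leq_add //; apply: leq_sum => v vA.
    by apply: (nbr_sum (co g)); rewrite in_setC vA.
  by apply: nbr_sum; rewrite -in_setC.
have cardA : #|A| + #|~: A| = #|V| := cardsC A.
(* A vertex outside [A] contributes its minimum, already counted in [mu]; a vertex of [A]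
   contributes at most [N]. *)
have P_le : #|arcs g| <= mu + #|A| * N.
  rewrite card_arcs (bigID (fun v => v \in A)) /= addnC Emu -sum_nat_const.
  rewrite -addnA [X in _ <= X]addnCA leq_add //.
    by rewrite (eq_bigl (fun v => v \in ~: A)) // => v; rewrite /= in_setC.
  rewrite -[X in X <= _]add0n leq_add // leq_sum // => v _.
  by rewrite -(dd v) leq_addr.
have P'_le : #|arcs (co g)| <= mu + #|~: A| * N.
  rewrite card_arcs (bigID (fun v => v \in A)) /= Emu -sum_nat_const -addnA leq_add //.
  rewrite -[X in X <= _]add0n leq_add //.
  rewrite (eq_bigl (fun v => v \in ~: A)) => [|v]; last by rewrite /= in_setC.
  by apply: leq_sum => v _; rewrite -(dd v) leq_addl.
(* The smaller of [A] and [~: A] is multiplied by [N], which is at most twice the larger one. By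
   [cross] this product is at most [2 * mu], hence the 3; [mu_le] supplies the other factor 2 of the
   6. *)
suff le3 : minn #|arcs g| #|arcs (co g)| <= 3 * mu.
  rewrite (leq_trans (leq_mul (leqnn N) le3)) // mulnCA -[6]/(3 * 2) -mulnA.
  by rewrite leq_mul2l /= mu_le.
rewrite geq_min; case: (leqP #|A| #|~: A|) => [AB|/ltnW BA]; apply/orP; [left|right].
  have /(leq_mul (leqnn #|A|)) : N <= 2 * #|~: A| by rewrite /N -cardA; lia.
  by rewrite mulnCA; lia.
have /(leq_mul (leqnn #|~: A|)) : N <= 2 * #|A| by rewrite /N -cardA; lia.
by rewrite mulnCA [#|~: A| * #|A|]mulnC; lia.
Qed.

(** With d + d' = n - 1, the sum of d (d - 1) is (n - 2) times the number of arcs, minus the sum of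
    d d'. The latter is the gain, bounded below by [sum_degree_products]. *)
Lemma cliques_arcs_bound g k : symmetric g -> 3 <= k -> 3 <= #|V| ->
  6 * (#|V| * #|V|.-1 * #|cliques g k|)
      + 'C(#|V|, k) * minn #|arcs g| #|arcs (co g)|
    <= 6 * ('C(#|V|, k) * #|arcs g|).
Proof.
move=> gS k3 V3.
have := cliques_degree_bound g k3; have := sum_degree_products gS.
set n := #|V| in V3 *; set mi := minn _ _; set K := #|cliques _ _|.
set D := \sum_v _; set S := \sum_v _; set c := 'C(_, _).
have SD : S + D = n.-2 * #|arcs g|.
  rewrite card_arcs big_distrr -big_split /=; apply: eq_bigr => v _.
  have := card_nbr_co g v; rewrite -/n; nia.
move=> H1 H2.
have n2 : 0 < n.-2 by lia.
rewrite -(leq_pmul2l n2).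
have : n.-2 * mi <= 6 * D by rewrite (leq_trans _ H1) // leq_mul2r leq_pred orbT.
nia.
Qed.

End Graphs.

(** * Rotations of the zigzag cycle *)

Section Walecki.
Variable N : nat.
Hypothesis N_gt0 : 0 < N.

(** Walecki's path 0, N - 1, 1, N - 2, ..., whose successive steps have lengths N - 1, N - 2, ...,
    1. *)
Definition zigzag (j : nat) := if odd j then N.-1 - j./2 else j./2.

(* The vertex N plays the role of the point at infinity. *)
Definition walecki (i j : nat) : 'I_N.+1 :=
  inord (if j < N then (zigzag j + i) %% N else N).

Lemma zigzag_lt j : j < N -> zigzag j < N.
Proof. by rewrite /zigzag; case: ifP; lia. Qed.

Lemma val_walecki i j :
  walecki i j = (if j < N then (zigzag j + i) %% N else N) :> nat.
Proof. by rewrite inordK //; case: ifP => // _; rewrite ltnW // ltnS ltn_mod. Qed.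

Lemma walecki_modn i j : walecki (i %% N) j = walecki i j.
Proof. by rewrite /walecki modnDmr. Qed.

Lemma walecki_inj i : {in gtn N.+1 &, injective (walecki i)}.
Proof.
move=> j j'; rewrite !inE !ltnS => jN j'N /(congr1 val) /=; rewrite !val_walecki.
case: ifP => jN'; case: ifP => j'N'.
- move/eqP; rewrite eqn_modDr !modn_small ?zigzag_lt // => /eqP.
  by rewrite /zigzag; case: ifP; case: ifP; lia.
- by have := ltn_pmod (zigzag j + i) N_gt0; lia.
- by have := ltn_pmod (zigzag j' + i) N_gt0; lia.
- by lia.
Qed.

(* The j-th edge of the i-th cycle, oriented from the lower to the higher end
   of the unrotated zigzag: for j < N.-1 the difference of its ends modulo N is
   N.-1 - j, independently of i. *)
Definition walecki_arc (b : 'I_N * 'I_N.+1) : 'I_N.+1 * 'I_N.+1 :=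
  let: (i, j) := b in
  if odd j && (j.+1 < N) then (walecki i j.+1, walecki i j)
  else (walecki i j, walecki i (j.+1 %% N.+1)).

Lemma walecki_arc_small (i : 'I_N) (j : 'I_N.+1) : j.+1 < N ->
  nat_of_ord (walecki_arc (i, j)).1 = (uphalf j + i) %% N /\
  nat_of_ord (walecki_arc (i, j)).2 = (uphalf j + i + (N.-1 - j)) %% N.
Proof.
move=> jN; rewrite /= (modn_small (leqW jN)).
rewrite jN andbT; case: ifP => oj; rewrite !val_walecki jN (ltnW jN);
  by rewrite /zigzag /= ?oj /=; split; congr (_ %% N); lia.
Qed.

(** If both ends are finite, their difference modulo [N] determines [j], and then the tail
    determines [i]. The slots [j = N.-1] and [j = N] give the arcs into and out of infinity, whose
    finite end determines [i]. *)
Lemma walecki_arc_inj : injective walecki_arc.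
Proof.
have small (b : 'I_N * 'I_N.+1) : b.2.+1 < N -> (walecki_arc b).1 < N /\ (walecki_arc b).2 < N.
  by case: b => i j /= /(walecki_arc_small i)[-> ->]; rewrite !ltn_mod.
have last1 (i : 'I_N) (j : 'I_N.+1) : j = N :> nat ->
    nat_of_ord (walecki_arc (i, j)).1 = N /\ nat_of_ord (walecki_arc (i, j)).2 = i.
  move=> jN; rewrite /= jN modnn (ltnNge N.+1 N) leqnSn andbF /=.
  rewrite !val_walecki ltnn N_gt0; split=> //.
  by rewrite /zigzag /= add0n modn_small ?ltn_ord.
have last2 (i : 'I_N) (j : 'I_N.+1) : j.+1 = N :> nat ->
    nat_of_ord (walecki_arc (i, j)).1 = (zigzag N.-1 + i) %% N /\
    nat_of_ord (walecki_arc (i, j)).2 = N.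
  move=> jN; rewrite /= jN ltnn andbF /= (modn_small (ltnSn N)) !val_walecki ltnn.
  have -> : j < N by lia.
  by have -> : N.-1 = j by lia.
move=> [i j] [i' j'] E.
have {}E : (walecki_arc (i, j)).1 = (walecki_arc (i', j')).1 :> nat
        /\ (walecki_arc (i, j)).2 = (walecki_arc (i', j')).2 :> nat by rewrite E.
have lt_mod x : x %% N < N by rewrite ltn_mod.
have cancel c : c + i = c + i' %[mod N] -> i = i'.
  by move/eqP; rewrite eqn_modDl !modn_small // => /eqP/val_inj.
have tri (l : 'I_N.+1) : [\/ l.+1 < N, l.+1 = N | l = N :> nat].
  case: (ltngtP l.+1 N) => [?|?|?]; [exact: Or31| |exact: Or32].
  by apply: Or33; have := ltn_ord l; lia.
suff [jj' ii'] : j = j' /\ i = i' by rewrite jj' ii'.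
have [jN|jN|jN] := tri j; have [j'N|j'N|j'N] := tri j'.
- move: E; have [-> ->] := walecki_arc_small i jN.
  have [-> ->] := walecki_arc_small i' j'N => -[E1 E2].
  have jj' : j = j'.
    have : uphalf j + i + (N.-1 - j) = uphalf j + i + (N.-1 - j') %[mod N].
      by rewrite E2 -modnDml -E1 modnDml.
    move/eqP; rewrite eqn_modDl !modn_small; try by lia.
    by move=> /eqP H; apply: val_inj => /=; lia.
  by split=> //; apply: (cancel (uphalf j)); rewrite E1 jj'.
- by have [_] := small (i, j) jN; case: E => _ ->; have [_ ->] := last2 i' _ j'N; rewrite ltnn.
- by have [+ _] := small (i, j) jN; case: E => -> _; have [-> _] := last1 i' _ j'N; rewrite ltnn.
- by have [_] := small (i', j') j'N; case: E => _ <-; have [_ ->] := last2 i _ jN; rewrite ltnn.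
- split; first by apply: val_inj => /=; lia.
  move: E; have [-> _] := last2 i _ jN; have [-> _] := last2 i' _ j'N => -[E _].
  exact: cancel E.
- have := lt_mod (zigzag N.-1 + i); have [<- _] := last2 i _ jN.
  by case: E => -> _; have [-> _] := last1 i' _ j'N; rewrite ltnn.
- by have [+ _] := small (i', j') j'N; case: E => <- _; have [-> _] := last1 i _ jN; rewrite ltnn.
- have := lt_mod (zigzag N.-1 + i'); have [<- _] := last2 i' _ j'N.
  by case: E => <- _; have [-> _] := last1 i _ jN; rewrite ltnn.
- split; first by apply: val_inj => /=; lia.
  move: E; have [_ ->] := last1 i _ jN; have [_ ->] := last1 i' _ j'N => -[_ E].
  exact: val_inj.
Qed.

Lemma walecki_next i (j : 'I_N.+1) : walecki i j != walecki i (j.+1 %% N.+1).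
Proof.
apply/eqP => /walecki_inj; rewrite !inE ltn_mod ltn_ord => /(_ isT isT) E.
have [jN|jN] : j.+1 < N.+1 \/ j.+1 = N.+1 by have := ltn_ord j; lia.
  by move: E; rewrite modn_small //; lia.
by move: E; rewrite jN modnn; case: jN; lia.
Qed.

Definition cycle_hits (g : rel 'I_N.+1) (i : nat) : nat :=
  \sum_(j < N.+1) g (walecki i j) (walecki i (j.+1 %% N.+1)).

(** The injection [walecki_arc] is onto the ordered pairs of distinct vertices, both sides having
    [N * N.+1] elements. By symmetry of [g] the chosen orientation does not affect the count. *)
Lemma walecki_arcs (g : rel 'I_N.+1) : symmetric g ->
  \sum_(i < N) cycle_hits g i = #|arcs g|.
Proof.
move=> gS.
have arc_ne b : (walecki_arc b).1 != (walecki_arc b).2.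
  case: b => i j /=; have := walecki_next i j.
  case: ifP => [/andP[_ jN]|_] //=; rewrite modn_small 1?eq_sym //; lia.
have arc_g b : g (walecki_arc b).1 (walecki_arc b).2
     = g (walecki b.1 b.2) (walecki b.1 (b.2.+1 %% N.+1)).
  case: b => i j /=; case: ifP => [/andP[_ jN]|_] //=.
  by rewrite (@modn_small j.+1) 1?gS //; lia.
rewrite pair_bigA /= -big_mkcond /= sum1dep_card.
rewrite -(card_imset _ walecki_arc_inj); congr #|pred_of_set _|.
have onto : walecki_arc @: setT = [set p | p.1 != p.2].
  apply/eqP; rewrite eqEcard; apply/andP; split.
    by apply/subsetP => _ /imsetP[b _ ->]; rewrite inE.
  rewrite card_imset; last exact: walecki_arc_inj.
  rewrite cardsT card_prod !card_ord.
  have -> : [set p | p.1 != p.2] = arcs (fun _ _ : 'I_N.+1 => true).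
    by apply/setP => p; rewrite !inE andbT.
  rewrite card_arcs (eq_bigr (fun=> N)) ?sum_nat_const ?card_ord 1?mulnC // => v _.
  rewrite -[RHS]/(N.+1.-1) -[in RHS](card_ord N.+1) -(cardsC1 v).
  by apply: eq_card => u; rewrite !inE andbT.
apply/setP => p; apply/imsetP/idP => [[b]|].
  by rewrite inE -arc_g => gb ->; rewrite inE arc_ne.
rewrite inE => /andP[pne gp].
have : p \in walecki_arc @: setT by rewrite onto inE.
by case/imsetP => b _ Ep; exists b => //; rewrite inE -arc_g -Ep.
Qed.

Lemma cycle_hits_modn g i : cycle_hits g (i %% N) = cycle_hits g i.
Proof. by apply: eq_bigr => j _; rewrite !walecki_modn. Qed.

Lemma walecki_periods (g : rel 'I_N.+1) q : symmetric g ->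
  \sum_(0 <= i < q * N) cycle_hits g i = q * #|arcs g|.
Proof.
move=> gS; elim: q => [|q IH]; first by rewrite !mul0n big_nil.
rewrite !mulSn (@big_cat_nat _ _ _ (q * N)) ?leq_addl //= IH addnC.
congr (_ + _); rewrite -{1}(add0n (q * N)) big_addn addnK big_mkord.
rewrite -walecki_arcs //; apply: eq_bigr => i _.
by rewrite -cycle_hits_modn addnC modnMDl modn_small.
Qed.

End Walecki.

(** * Hall's condition *)

(** Complementation maps the supersets of [D] to the subsets of [~: D]. *)
Lemma card_supersets (V : finType) (D : {set V}) k : k <= #|V| ->
  #|[set e : {set V} | (D \subset e) && (#|e| == k)]| = 'C(#|V| - #|D|, #|V| - k).
Proof.
move=> kV; have -> : #|V| - #|D| = #|~: D| by rewrite [RHS]cardsCs setCK.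
rewrite -cards_draws -(card_imset _ (@setC_inj V)).
apply: eq_card => f; rewrite inE; apply/imsetP/andP => [[e]|[fD /eqP fk]].
  by rewrite inE => /andP[De /eqP ek] ->; rewrite setCS De cardsCs setCK ek.
exists (~: f); rewrite ?setCK // inE cardsCs setCK fk subKn // eqxx andbT.
by rewrite -setCS setCK.
Qed.

(** Binomials increase up to the middle ([half], [low]); beyond it, [k] is reflected to [n - k],
    still at least [j]. *)
Lemma leq_bin_sym n j k : j <= k -> k + j <= n -> 'C(n, j) <= 'C(n, k).
Proof.
have half i : i.*2 < n -> 'C(n, i) <= 'C(n, i.+1).
  move=> i2; rewrite -(leq_pmul2l (ltn0Sn i)) mul_bin_left leq_mul2r.
  by apply/orP; right; lia.
have low k' : j <= k' -> k'.*2 <= n -> 'C(n, j) <= 'C(n, k').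
  elim: k' => [|k' IH] jk' k'2; first by have -> : j = 0 by lia.
  have [->//|jk] := eqVneq j k'.+1.
  by apply: leq_trans (half k' _); [apply: IH; lia | lia].
move=> jk kjn; have [k2|k2] := leqP k.*2 n; first exact: low.
by rewrite -(@bin_sub n k); [apply: low; lia | lia].
Qed.

Section HallCondition.
Variables (N k m : nat) (M : {set {set 'I_N.+1}}).
Hypotheses (N_gt0 : 0 < N) (k3 : 3 <= k) (kN : k <= N).
Hypothesis sub_M : M \subset 'K_N.+1^(k).
Let A := 'K_N.+1^(k) :\: M.
Hypothesis card_A : #|A| = m * N.+1.
Implicit Types (S : {set {set 'I_N.+1}}) (g : rel 'I_N.+1).

(** A slot is a neighbour of [S] exactly when its cycle edge lies in this graph, so Hall's condition
    depends on [S] only through its size and its shadow. *)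
Definition shadow S : rel 'I_N.+1 :=
  fun u v => [exists e in S, (u \in e) && (v \in e)].

Lemma shadow_sym S : symmetric (shadow S).
Proof. by move=> u v; apply: eq_existsb => e; rewrite [(u \in e) && _]andbC. Qed.

Lemma card_complete : #|'K_N.+1^(k)| = 'C(N.+1, k).
Proof.
rewrite -[in RHS](card_ord N.+1) -[in RHS]cardsT -cards_draws.
by apply: eq_card => e; rewrite !inE subsetT.
Qed.

Lemma card_A_M : m * N.+1 + #|M| = 'C(N.+1, k).
Proof. by rewrite -card_A -card_complete cardsDS // subnK // subset_leq_card. Qed.

Lemma sub_cliques_shadow S : S \subset A -> S \subset cliques (shadow S) k.
Proof.
move=> SA; apply/subsetP => e eS; apply/cliqueP; split.
  by have := subsetP SA e eS; rewrite !inE => /andP[_ /eqP].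
by move=> u v ue ve _; apply/exists_inP; exists e; rewrite ?ue.
Qed.

Let hits := neighbours (@cycle_edge_in N.+1 m (walecki N)).

Lemma card_hits S : #|hits S| = \sum_(0 <= i < m) cycle_hits (shadow S) i.
Proof.
rewrite big_mkord pair_bigA /= -big_mkcond /= sum1dep_card.
by apply: eq_card => b; rewrite !inE.
Qed.

(** The [m] rotations contain [q] full periods and fit into [q.+1] of them; this rounding is the
    error to be absorbed. *)
Let q := m %/ N.

Lemma card_hits_ge S : q * #|arcs (shadow S)| <= #|hits S|.
Proof.
rewrite card_hits -walecki_periods //; last exact: shadow_sym.
by rewrite (@big_cat_nat _ _ _ (q * N) 0 m) ?leq_addr ?leq_divM.
Qed.

Lemma card_hits_co S : m * N.+1 <= #|hits S| + q.+1 * #|arcs (co (shadow S))|.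
Proof.
have coS : symmetric (co (shadow S)) by move=> u v; rewrite /co shadow_sym.
rewrite card_hits -(walecki_periods N_gt0) //.
have mq : m <= q.+1 * N by rewrite ltnW // ltn_ceil.
rewrite [X in _ + X](@big_cat_nat _ _ _ m) //= addnA -big_split /=.
rewrite (eq_bigr (fun=> N.+1)) ?sum_nat_const_nat ?subn0 ?leq_addr // => i _.
rewrite -big_split /= (eq_bigr (fun=> 1)) ?sum_nat_const ?card_ord ?muln1 // => j _.
by rewrite /co; case: (shadow _ _ _).
Qed.

(* Here P and P' count ordered pairs. When the shadow is dense, the Hall
   condition is checked on the pairs outside of it. *)
Lemma Hall_of_clique_bounds :
    6 * (N.+1 * N + #|M|) <= 'C(N.+1, k) ->
    (forall g, symmetric g -> let P' := #|arcs (co g)| in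
       #|cliques g k| + #|M :\: cliques g k| + q.+1 * P' <= 'C(N.+1, k)
       \/ 6 * (N.+1 * N) * (#|M :\: cliques g k| + P') <= 'C(N.+1, k) * P') ->
  forall S, S \subset A -> #|S| <= #|hits S|.
Proof.
move=> C6 dense S SA; set g := shadow S.
have gS : symmetric g by apply: shadow_sym.
have := cliques_arcs_bound gS k3; rewrite card_ord /= => /(_ (leq_trans k3 (leqW kN))).
have := card_arcs_co g; rewrite card_ord /=.
have := card_hits_ge S; have := card_hits_co S; rewrite -/g.
have := card_A_M; have := leq_divM m N; have := ltn_ceil m N_gt0; rewrite -/q.
have Kg := sub_cliques_shadow SA; have := dense g gS; rewrite /=.
(* [S] avoids the deleted edges, so those that are cliques of the shadow are subtracted from the
   clique bound. *)
have : #|S| + #|M :&: cliques g k| <= #|cliques g k|.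
  have SM0 : S :&: (M :&: cliques g k) = set0.
    apply/setP => e; rewrite inE in_set0; apply/andP => -[eS /setIP[eM _]].
    by have := subsetP SA e eS; rewrite inE eM.
  rewrite -[X in X <= _]subn0 -(cards0 {set 'I_N.+1}) -SM0 -cardsU.
  by rewrite subset_leq_card // subUset Kg subsetIr.
have := cardsID (cliques g k) M.
move: #|hits S| #|S| #|cliques g k| #|M :&: _| #|M :\: _| #|M| #|arcs g| #|arcs _| C6.
move: 'C(_, _) => C h s K MI MD M0 P P' C6 EM sK D mq qm EC h_co h_ge EP kk.
have N1 : 0 < N.+1 by [].
(* Sparse shadow: [kk] leaves a gain of [C * P] out of [6 * C * P]. Since [C] exceeds [N.+1 * N * q]
   by at most [N.+1 * N + M0], which is at most a sixth of [C], this yields [K <= q * P]. *)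
have [le_P|lt_P] := leqP P P'.
  rewrite (minn_idPl le_P) in kk.
  apply: leq_trans h_ge; apply: leq_trans (_ : K <= _); first lia.
  rewrite -(leq_pmul2l N_gt0) -(leq_pmul2l N1).
  have C_le : C <= N.+1 * (N * q) + (N.+1 * N + M0).
    by have := leq_mul (ltnW mq) (leqnn N.+1); rewrite -EC; lia.
  have := leq_mul C_le (leqnn P); have := leq_mul C6 (leqnn P).
  lia.
rewrite (minn_idPr (ltnW lt_P)) in kk.
suff : K + MD + q.+1 * P' <= C by lia.
(* In the second alternative the gain [C * P'] pays for the deleted edges [MD] and for the one extra
   period [P']. *)
case: D => // D; rewrite -(leq_pmul2l N_gt0) -(leq_pmul2l N1).
have C_ge : N.+1 * (N * q) <= C.
  by have := leq_mul qm (leqnn N.+1); rewrite -EC; lia.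
have := leq_mul C_ge (leqnn P'); have := congr1 (muln C) EP; lia.
Qed.

Lemma decomposition_of_clique_bounds :
    6 * (N.+1 * N + #|M|) <= 'C(N.+1, k) ->
    (forall g, symmetric g -> let P' := #|arcs (co g)| in
       #|cliques g k| + #|M :\: cliques g k| + q.+1 * P' <= 'C(N.+1, k)
       \/ 6 * (N.+1 * N) * (#|M :\: cliques g k| + P') <= 'C(N.+1, k) * P') ->
  has_Hamilton_Berge_decomposition A.
Proof.
move=> C6 dense.
apply: (@Hamilton_Berge_decomposition_of_Hall _ m (walecki N)) => //.
  exact: walecki_inj.
exact: Hall_of_clique_bounds.
Qed.

Lemma card_pair_supersets (u v : 'I_N.+1) : u != v ->
  #|[set e in 'K_N.+1^(k) | (u \in e) && (v \in e)]| = 'C(N.-1, k.-2).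
Proof.
move=> uv; have -> : [set e in 'K_N.+1^(k) | (u \in e) && (v \in e)]
    = [set e : {set 'I_N.+1} | ([set u; v] \subset e) && (#|e| == k)].
  by apply/setP => e; rewrite !inE subUset !sub1set andbC.
rewrite card_supersets card_ord; last exact: leqW.
rewrite cards2 uv -(@bin_sub _ k.-2); last by lia.
by congr 'C(_, _); lia.
Qed.

(** Split on the number [P'] of missing arcs. From 10 on, the gain, proportional to [P'], outweighs
    up to [N.+1] deleted edges. With none missing, every deleted edge is a clique. In between, the
    [k]-sets through one missing pair suffice. *)
Lemma decomposition_few_deleted :
    4 <= k -> #|M| <= N.+1 -> N.+1 * N * (3 * N.+1 + 30) <= 5 * 'C(N.+1, k) ->
  has_Hamilton_Berge_decomposition A.
Proof.
move=> k4 MN C5; apply: decomposition_of_clique_bounds; first by nia.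
move=> g gS P'; have MD : #|M :\: cliques g k| <= N.+1.
  by rewrite (leq_trans _ MN) // subset_leq_card // subsetDl.
have [P10|P10] := leqP 10 P'; first by right; nia.
have [P0|] := posnP P'.
  right; rewrite P0 addn0 muln0 leqn0 muln_eq0 cards_eq0 setD_eq0.
  apply/orP; right; apply/subsetP => e eM; apply/cliqueP; split.
    by have := subsetP sub_M e eM; rewrite inE => /eqP.
  move=> u v _ _ uv; apply/negPn/negP => guv.
  by have := card0_eq P0 (u, v); rewrite !inE /= uv /co guv.
rewrite card_gt0 => /set0Pn[[u v]]; rewrite inE /= => /andP[uv guv]; left.
have KC : #|cliques g k| + 'C(N.-1, k.-2) <= 'C(N.+1, k).
  rewrite -(card_pair_supersets uv) -card_complete -leq_subRL; last first.
    rewrite subset_leq_card //; apply/subsetP => e /cliqueP[ek _].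
    by rewrite inE ek.
  rewrite -cardsDS; last by apply/subsetP => e /cliqueP[ek _]; rewrite inE ek.
  rewrite subset_leq_card //; apply/subsetP => e; rewrite !inE.
  case/andP => -> /andP[ue ve]; rewrite andbT; apply: contra guv => /andP[_].
  by move/forall_inP/(_ u ue)/forall_inP/(_ v ve)/implyP/(_ uv).
have := mul_bin_diag2 N.+1 k.-2; have -> : k.-2.+2 = k by lia.
rewrite /=; have := card_A_M; have := leq_divM m N; rewrite -/q.
move: KC MD C5 MN; move: #|M :\: _| #|M| #|cliques _ _| 'C(N.-1, _) 'C(N.+1, _).
move=> MD M0 K B C KC leMD C5 MN qm EC EB.
(* A missing pair excludes [B] of the [k]-sets, and k (k - 1) is at least 12. Of these [12 * C], at
   most [10 * C] pays for [q * P']; by [C5], [2 * C] covers [MD + P']. *)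
have C12 : 12 * C <= N.+1 * (N * B).
  rewrite -EB mulnA leq_mul2r; apply/orP; right.
  by have : 4 * 3 <= k * k.-2.+1 by apply: leq_mul; lia.
suff : N.+1 * (N * (MD + q.+1 * P')) <= 12 * C.
  by move/leq_trans/(_ C12); rewrite !leq_pmul2l //; lia.
have C_ge : N.+1 * (N * q) <= C.
  by have := leq_mul qm (leqnn N.+1); rewrite -EC; lia.
have := leq_mul C_ge (leqnn P').
have : N.+1 * N * (MD + P') <= N.+1 * N * (N.+1 + 10) by rewrite leq_mul2l; lia.
have : C * P' <= C * 10 by rewrite leq_mul2l; lia.
lia.
Qed.

(** Each deleted edge that is not a clique contains a missing arc, and disjoint edges contain
    different ones. Hence at most [P'] of them count, and the error [6 * (2 * P')] explains the
    12. *)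
Lemma decomposition_deleted_matching :
    trivIset M -> #|M| <= N.+1 * N -> 12 * (N.+1 * N) <= 'C(N.+1, k) ->
  has_Hamilton_Berge_decomposition A.
Proof.
move=> tM MN C12; apply: decomposition_of_clique_bounds; first by lia.
move=> g gS P'; right.
suff : #|M :\: cliques g k| <= P' by nia.
have arcP e : e \in M :\: cliques g k ->
    exists p, [&& p \in arcs (co g), p.1 \in e & p.2 \in e].
  case/setDP => eM; rewrite inE; have := subsetP sub_M e eM; rewrite inE => -> /=.
  rewrite negb_forall_in => /exists_inP[u ue]; rewrite negb_forall_in.
  case/exists_inP => v ve; rewrite negb_imply => /andP[uv guv].
  by exists (u, v); rewrite inE /= /co uv guv ue ve.
pose arc_of (e : {set 'I_N.+1}) :=
  odflt (ord0, ord0) [pick p | [&& p \in arcs (co g), p.1 \in e & p.2 \in e]].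
have arc_ofP e : e \in M :\: cliques g k ->
    (arc_of e \in arcs (co g)) && ((arc_of e).1 \in e).
  move/arcP; rewrite /arc_of; case: pickP => [p /and3P[-> -> _] //|p0 [p]].
  by rewrite p0.
rewrite -(@card_in_imset _ _ arc_of) => [|e e' eM e'M E].
  by apply/subset_leq_card/subsetP => _ /imsetP[e /arc_ofP/andP[? _] ->].
apply: contraTeq isT => ee'; have /trivIsetP/(_ e e') := tM.
case/setDP: (eM) => -> _; case/setDP: (e'M) => -> _ /(_ isT isT ee') /pred0P.
move/(_ (arc_of e).1) => /=; have /andP[_ ->] := arc_ofP _ eM.
by rewrite E; have /andP[_ ->] := arc_ofP _ e'M.
Qed.

(** Each of the [N.+1 - k] vertices outside [e] spoils at most two edges of the cycle. *)
Lemma cycle_hits_clique S e i : e \in S -> #|e| = k ->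
  2 * k <= cycle_hits (shadow S) i + N.+1.
Proof.
move=> eS ek.
have sum_out (f : 'I_N.+1 -> 'I_N.+1) : injective f ->
    \sum_(j < N.+1) (f j \notin e : nat) = N.+1 - k.
  move=> fI; rewrite -(reindex_inj fI (P := xpredT) (F := fun j => nat_of_bool (j \notin e))) /=.
  rewrite -big_mkcond sum1dep_card.
  have -> : #|[set j | j \notin e]| = #|~: e| by apply: eq_card => j; rewrite !inE.
  by have := cardsC e; rewrite card_ord ek; lia.
have out1 := sum_out (walecki N i)
  (fun x y E => val_inj (walecki_inj N_gt0 (ltn_ord x) (ltn_ord y) E)).
have next_inj : injective (fun j : 'I_N.+1 => walecki N i (j.+1 %% N.+1)).
  move=> x y /(walecki_inj N_gt0); rewrite !inE !ltn_mod => /(_ isT isT) /eqP.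
  rewrite -[x.+1]addn1 -[y.+1]addn1 eqn_modDr !modn_small // => /eqP; exact: val_inj.
have out2 := sum_out _ next_inj.
have : N.+1 <= cycle_hits (shadow S) i + (N.+1 - k) + (N.+1 - k).
  rewrite -{2}out1 -out2 -!big_split /= -[X in X <= _](card_ord N.+1) -sum1_card.
  apply: leq_sum => j _.
  have [w1|] := boolP (walecki N i j \in e); last by rewrite addn1; lia.
  have [w2|] := boolP (walecki N i (j.+1 %% N.+1) \in e); last by rewrite addn1.
  have -> // : shadow S (walecki N i j) (walecki N i (j.+1 %% N.+1)).
  by apply/exists_inP; exists e; rewrite ?w1.
lia.
Qed.

(** A nonempty [S] reaches at least half of the slots. If it misses one, it contains none of the
    [k]-sets through that pair, and so has at most half of the [m * N.+1] available sets. *)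
Lemma decomposition_large_uniformity :
    3 * N.+1 <= 4 * k -> 'C(N.+1, k) + #|M| <= 2 * 'C(N.-1, k.-2) ->
  has_Hamilton_Berge_decomposition A.
Proof.
move=> k34 CM.
apply: (@Hamilton_Berge_decomposition_of_Hall _ m (walecki N)) => //.
  exact: walecki_inj.
move=> S SA; rewrite -/hits.
have [->|/set0Pn[e eS]] := eqVneq S set0; first by rewrite cards0.
have [hT|] := eqVneq (hits S) setT.
  by rewrite hT cardsT card_prod !card_ord -card_A subset_leq_card.
rewrite -subTset => /subsetPn[[i j] _ nij].
have ek : #|e| = k by have := subsetP SA e eS; rewrite !inE => /andP[_ /eqP].
have hits_ge : m * N.+1 <= 2 * #|hits S|.
  rewrite card_hits big_distrr -[m in X in X <= _]subn0 -sum_nat_const_nat /=.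
  apply: leq_sum => i' _; have := cycle_hits_clique i' eS ek; lia.
have := card_pair_supersets (walecki_next N_gt0 i j).
set B := [set _ in _ | _] => cardB.
have : #|S| + #|B| <= 'C(N.+1, k).
  have SB0 : S :&: B = set0.
    apply/setP => f; rewrite inE in_set0; apply/andP => -[fS /setIdP[_ fw]].
    by case/negP: nij; apply/neighboursP; exists f.
  rewrite -[X in X <= _]subn0 -(cards0 {set 'I_N.+1}) -SB0 -cardsU -card_complete.
  rewrite subset_leq_card // subUset (subset_trans SA (subsetDl _ _)) /=.
  by apply/subsetP => f /setIdP[].
have := card_A_M; lia.
Qed.

End HallCondition.

(** * Binomial estimates *)

(** For [k] at least 5, 4 k < 3 n and n >= 20 give k + 5 <= n, so ['C(n, k)] is at least ['C(n, 5)].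
    Both cases then become polynomial inequalities, shifted to start at 0. *)
Lemma few_deleted_bound k n :
    (4 < k) && (19 < n) && (4 * k < 3 * n) || (k == 4) && (29 < n) ->
  n * n.-1 * (3 * n + 30) <= 5 * 'C(n, k).
Proof.
have ffact_bin d : n ^_ d = 'C(n, d) * d`! by rewrite bin_ffact.
case/orP => [/andP[/andP[k5 n20] kn]|/andP[/eqP-> n30]].
  have := @leq_bin_sym n 5 k k5 ltac:(lia); have := ffact_bin 5.
  have [x ->] : exists x, n = x + 20 by exists (n - 20); lia.
  rewrite !ffactnS ffactn0 -[5`!]/120 !addnS /=.
  set C5 := 'C(_, 5); set C := 'C(_, k) => E5 le5; nia.
have := ffact_bin 4; have [x ->] : exists x, n = x + 30 by exists (n - 30); lia.
rewrite !ffactnS ffactn0 -[4`!]/24 !addnS /=; set C4 := 'C(_, 4) => E4; nia.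
Qed.

(** After cancelling [n * n.-1] this says 72 <= n - 2. *)
Lemma triples_bound n : 74 <= n -> 12 * (n * n.-1) <= 'C(n, 3).
Proof.
move=> n74; have : n ^_ 3 = 'C(n, 3) * 3`! by rewrite bin_ffact.
have [x ->] : exists x, n = x + 74 by exists (n - 74); lia.
rewrite !ffactnS ffactn0 -[3`!]/6 !addnS /=; set C := 'C(_, _) => E3; nia.
Qed.

(** By [kk], the right side exceeds [C] by at least 2 C / n, which is at least n - 1 because [C] is
    at least ['C(n, 2)]. *)
Lemma large_uniformity_bound k n p : 20 <= n -> 3 * n <= 4 * k -> k + 2 <= n ->
  p < n -> 'C(n, k) + p <= 2 * 'C(n.-2, k.-2).
Proof.
move=> n20 nk kn pn.
have := mul_bin_diag2 n k.-2; have -> : k.-2.+2 = k by lia.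
have -> : k.-2.+1 = k.-1 by lia.
have := @leq_bin_sym n 2 k ltac:(lia) ltac:(lia).
have : 2 * 'C(n, 2) = n * n.-1 by rewrite -mul_bin_diag bin1.
set C := 'C(n, k); set B := 'C(_, _); set C2 := 'C(n, 2) => E2 le2 EB.
(* With k at least 3 n / 4 this follows from n^2 + 16 >= 20 n, where [n20] enters. *)
have kk : n * n.-1 + 2 * n.-1 <= 2 * (k * k.-1).
  have : (3 * n) * (3 * n - 4) <= (4 * k) * (4 * k.-1) by apply: leq_mul; lia.
  nia.
have n1 : 0 < n * n.-1 by rewrite muln_gt0; lia.
rewrite -(leq_pmul2l n1).
have := leq_mul kk (leqnn C); have := leq_mul (leqnn (2 * n.-1)) le2.
have : n * n.-1 * p <= n * n.-1 * n.-1 by rewrite leq_mul2l; lia.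
have := congr1 (muln n.-1) E2; have := congr1 (muln 2) EB.
lia.
Qed.

(** * Choice of the criterion in each range of the parameters *)

Theorem theorem1p2 (k n : nat) (hkn : 3 <= k < n) :
  ((5 <= k /\ 20 <= n) \/ (k = 4 /\ 30 <= n) ->
   forall M : {set {set 'I_n}},
     M \subset 'K_n^(k) -> #|M| < n -> n %| #|'K_n^(k) :\: M| ->
     has_Hamilton_Berge_decomposition ('K_n^(k) :\: M))
  /\
  (k = 3 /\ 100 <= n ->
   forall M : {set {set 'I_n}},
     (if n %| 'C(n, 3) then M = set0 else perfect_matching 'K_n^(3) M) ->
     has_Hamilton_Berge_decomposition ('K_n^(3) :\: M)).
Proof.
case: n hkn => [|N] /andP[k3 kN]; first by lia.
have N_gt0 : 0 < N by lia.
split=> [kn M sM MN /dvdnP[m card_A]|[_ n100] M].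
  have [k34|k34] := leqP (3 * N.+1) (4 * k).
    apply: (decomposition_large_uniformity N_gt0 k3 kN sM card_A k34).
    have [kN2|kN1] := leqP (k + 2) N.+1; first by apply: large_uniformity_bound; lia.
    (* Here [k = N] and there are only [N.+1] edges, so divisibility and [#|M| < N.+1] force [M] to
       be empty. *)
    have EM := card_A_M sM card_A.
    have {EM} : m * N.+1 + #|M| = N.+1.
      by rewrite EM (_ : k = N) ?binSn //; lia.
    have -> : k = N by lia.
    have C1 y : 0 < y -> 'C(y, y.-1) = y by case: y => // y _; rewrite binSn.
    rewrite binSn C1; last by lia.
    case: m {card_A} => [|m]; rewrite ?mulSn; lia.
  apply: (decomposition_few_deleted N_gt0 k3 kN sM card_A); try lia.
  by apply: few_deleted_bound; case: kn => -[? ?]; apply/orP; [left|right]; lia.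
have bound := @triples_bound N.+1 ltac:(lia).
have N3 : 3 <= N by lia.
move=> hM; suff [sM tM MN dvdA] : [/\ M \subset 'K_N.+1^(3), trivIset M, #|M| <= N.+1 * N
                      & N.+1 %| #|'K_N.+1^(3) :\: M|].
  by case/dvdnP: dvdA => m card_A;
    apply: (decomposition_deleted_matching N_gt0 (leqnn 3) N3 sM card_A).
case: ifP hM => [dvd ->|ndvd [sM tM cM]].
  rewrite sub0set cards0 setD0 card_complete //; split=> //.
  by apply/trivIsetP => e e'; rewrite inE.
have M3 : #|M| * 3 = N.+1.
  rewrite -sum_nat_const -[RHS]card_ord -cardsT -cM -(eqP tM).
  by apply: eq_bigr => e /(subsetP sM); rewrite inE => /eqP.
split=> //; first by nia.
rewrite cardsDS // card_complete.
have E3 : N.+1 ^_ 3 = 'C(N.+1, 3) * 3`! by rewrite bin_ffact.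
have E2 : 2 * 'C(#|M|, 2) = #|M| * #|M|.-1 by rewrite -mul_bin_diag bin1.
move: E3; rewrite !ffactnS ffactn0 -[3`!]/6 muln1 => E3.
(* With n = 3 s and s = [#|M|], C(n, 3) - s = 9 s^2 (s - 1) / 2 = n * 3 C(s, 2). *)
apply/dvdnP; exists (3 * 'C(#|M|, 2)).
move: E3 E2 M3; set C2 := 'C(_, 2); set C := 'C(_, 3); case: #|M| => [|t] E3 E2 M3; first by lia.
have EN : N = 3 * t + 2 by lia.
have N1 : N.-1 = 3 * t + 1 by lia.
rewrite /= N1 EN in E3 E2 *.
have := congr1 (muln t.+1) E2; lia.
Qed.
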